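(* Let $D = [x_{j}(m_{j}); y_{i}(n_{i})]_{s,t}$ be a signed $(s,t)$-simplex in a real or complex inner product space $X$ with induced norm $\|\cdot\|$. Then the following conditions are equivalent: (1) $\gamma_{2}(D) = 0$. (2) $\sum_{j=1}^{s} m_{j}x_{j} = \sum_{i=1}^{t} n_{i}y_{i}$.
   Context: A signed $(s,t)$-simplex in a set $X$ ($s,t>0$ integers) is a collection of (not necessarily distinct) points $x_{1},\ldots,x_{s},y_{1},\ldots,y_{t}\in X$ together with real numbers $m_{1},\ldots,m_{s},n_{1},\ldots,n_{t}$ satisfying $m_{1}+\cdots+m_{s}=n_{1}+\cdots+n_{t}$; it is denoted $D=[x_{j}(m_{j});y_{i}(n_{i})]_{s,t}$. The $2$-simplex gap of $D$ is $$\gamma_{2}(D) = \sum_{j=1}^{s}\sum_{i=1}^{t} m_{j}n_{i}\|x_{j}-y_{i}\|^{2} - \sum_{1 \leq j_{1} < j_{2} \leq s} m_{j_{1}}m_{j_{2}}\|x_{j_{1}}-x_{j_{2}}\|^{2} - \sum_{1 \leq i_{1} < i_{2} \leq t} n_{i_{1}}n_{i_{2}}\|y_{i_{1}}-y_{i_{2}}\|^{2}.$$ *)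

(* Defs.v *)
From HB Require Import structures.
From mathcomp Require Import all_boot all_order all_algebra.
From mathcomp Require Import sesquilinear reals complex.

Set Implicit Arguments.
Unset Strict Implicit.
Unset Printing Implicit Defensive.

Import Order.TTheory GRing.Theory Num.Theory.
Local Open Scope ring_scope.

(* The points need not be distinct, and the weights may have any sign. *)
Record signed_simplex (R : realType) (X : Type) (s t : nat) := SignedSimplex {
  xpt : 'I_s -> X;
  ypt : 'I_t -> X;
  xwt : 'I_s -> R;
  ywt : 'I_t -> R;
  wt_balance : \sum_(j < s) xwt j = \sum_(i < t) ywt i
}.

Definition gamma2 (R : realType) (X : zmodType) (normX : X -> R) (s t : nat)
    (D : signed_simplex R X s t) : R :=
  \sum_(j < s) \sum_(i < t)
     xwt D j * ywt D i * normX (xpt D j - ypt D i) ^+ 2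
  - \sum_(j1 < s) \sum_(j2 < s | (j1 < j2)%N)
       xwt D j1 * xwt D j2 * normX (xpt D j1 - xpt D j2) ^+ 2
  - \sum_(i1 < t) \sum_(i2 < t | (i1 < i2)%N)
       ywt D i1 * ywt D i2 * normX (ypt D i1 - ypt D i2) ^+ 2.

Definition rnorm (R : realType) (X : lmodType R) (ip : {dot X for @idfun R})
    (u : X) : R :=
  Num.sqrt (ip u u).

(* [ip u u] is a nonnegative real element of [R[i]]; its real part is used so
   that norms, hence gaps, take values in [R]. *)
Definition cnorm (R : realType) (X : lmodType R[i])
    (ip : {dot X for @Num.conj R[i]}) (u : X) : R :=
  Num.sqrt (complex.Re (ip u u)).

(* Main.v *)
(** Both norms come from a positive definite symmetric real bilinear form [b]
    (the real part of the inner product in the complex case).  Expanding each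
    squared distance as [b u u + b v v - 2 b u v], the balance of the weights
    makes the diagonal terms cancel, so the gap equals [b z z] for
    [z = \sum_j m_j x_j - \sum_i n_i y_i], which vanishes iff [z = 0]. *)

Require Import Defs.
From HB Require Import structures.
From mathcomp Require Import all_boot all_order all_algebra.
From mathcomp Require Import sesquilinear reals complex.
From mathcomp Require Import ring.

Set Implicit Arguments.
Unset Strict Implicit.
Unset Printing Implicit Defensive.

Import Order.TTheory GRing.Theory Num.Theory.
Local Open Scope ring_scope.

(** The diagonal contributes nothing, and transposing the indices carries the lower triangle onto
    the upper one. *)
Lemma double_sum_ltn (V : zmodType) (n : nat) (F : 'I_n -> 'I_n -> V) :
  (forall i j, F i j = F j i) -> (forall i, F i i = 0) ->
  (\sum_(i < n) \sum_(j < n | (i < j)%N) F i j) *+ 2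
    = \sum_(i < n) \sum_(j < n) F i j.
Proof.
move=> symF diagF.
have -> : \sum_(i < n) \sum_(j < n) F i j
    = \sum_(i < n) \sum_(j < n | (i < j)%N) F i j
      + \sum_(i < n) \sum_(j < n | (j < i)%N) F i j.
  rewrite -big_split; apply: eq_bigr => i _ /=.
  rewrite (bigID (fun j : 'I_n => (i < j)%N)) /=; congr (_ + _).
  rewrite (bigD1 i) ?ltnn //= diagF add0r; apply: eq_bigl => j.
  by rewrite -leqNgt ltn_neqAle andbC.
rewrite mulr2n; congr (_ + _).
rewrite (exchange_big_dep predT) //=; apply: eq_bigr => i _.
by apply: eq_bigr => j _; rewrite symF.
Qed.

(** With squared norms for [f] and [g] and inner products for [h], this expands a weighted sum of
    squared distances. It serves both for the mixed pairs and for the pairs within one group. *)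
Lemma sum_weighted_dist (R : comPzRingType) (I J : finType) (m : I -> R)
    (n : J -> R) (f : I -> R) (g : J -> R) (h : I -> J -> R) :
  \sum_i \sum_j m i * n j * (f i + g j - h i j *+ 2)
  = (\sum_i m i * f i) * (\sum_j n j) + (\sum_i m i) * (\sum_j n j * g j)
    - (\sum_i \sum_j m i * n j * h i j) *+ 2.
Proof.
rewrite !mulr_suml -sumrMnl -big_split -sumrB; apply: eq_bigr => i _ /=.
rewrite !mulr_sumr -sumrMnl -big_split -sumrB; apply: eq_bigr => j _ /=.
ring.
Qed.

Section RealForm.

(* [sc] is left abstract because a complex space carries no canonical
   structure of real module. *)
Variables (R : realType) (X : zmodType) (sc : R -> X -> X) (b : X -> X -> R).
Hypothesis bC : forall u v, b u v = b v u.
Hypothesis bBl : forall u v w, b (u - v) w = b u w - b v w.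
Hypothesis bZl : forall a u v, b (sc a u) v = a * b u v.
Hypothesis b_ge0 : forall u, 0 <= b u u.

Lemma form_subl_sqr u v : b (u - v) (u - v) = b u u + b v v - b u v *+ 2.
Proof. by rewrite bBl ![b _ (u - v)]bC !bBl (bC v u); ring. Qed.

Lemma form_suml (I : finType) (F : I -> X) w : b (\sum_i F i) w = \sum_i b (F i) w.
Proof.
have b0 : b 0 w = 0 by rewrite -{1}(subrr 0) bBl subrr.
apply: (big_morph (b^~ w) _ b0) => u v.
(* Only compatibility with subtraction is assumed, so [u + v] is written as [u - (0 - v)]. *)
by rewrite -{1}(opprK v) -(sub0r v) !bBl b0 sub0r opprK.
Qed.

Lemma form_comb (I J : finType) (m : I -> R) (n : J -> R) (x : I -> X)
    (y : J -> X) :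
  b (\sum_i sc (m i) (x i)) (\sum_j sc (n j) (y j))
    = \sum_i \sum_j m i * n j * b (x i) (y j).
Proof.
rewrite form_suml; apply: eq_bigr => i _; rewrite bC form_suml.
by apply: eq_bigr => j _; rewrite bZl bC bZl; ring.
Qed.

Lemma gamma2_form (s t : nat) (D : signed_simplex R X s t) :
  gamma2 (fun u => Num.sqrt (b u u)) D
  = let z := \sum_j sc (xwt D j) (xpt D j) - \sum_i sc (ywt D i) (ypt D i) in
    b z z.
Proof.
have dist2 u v : Num.sqrt (b (u - v) (u - v)) ^+ 2 = b u u + b v v - b u v *+ 2.
  by rewrite sqr_sqrtr // form_subl_sqr.
(* Within one group, the subtracted double sum is [b w w] for the weighted sum [w] of the points. *)
have pairs (k : nat) (m : 'I_k -> R) (p : 'I_k -> X) :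
    (\sum_(i < k) \sum_(j < k | (i < j)%N)
       m i * m j * Num.sqrt (b (p i - p j) (p i - p j)) ^+ 2)
    = (\sum_i m i * b (p i) (p i)) * (\sum_i m i)
      - \sum_i \sum_j m i * m j * b (p i) (p j).
  (* Doubling turns the sum over [i < j] into a full double sum, where the expansion factors. *)
  apply: (@pmulrnI _ 2) => //; rewrite double_sum_ltn => [|i j|i]; last 2 first.
  - by rewrite !dist2 (bC (p j) (p i)); ring.
  - by rewrite dist2; ring.
  under eq_bigr do under eq_bigr do rewrite dist2.
  rewrite (sum_weighted_dist m m (fun i => b (p i) (p i)) (fun i => b (p i) (p i))
    (fun i j => b (p i) (p j))); ring.
rewrite /= form_subl_sqr !form_comb /gamma2.
under eq_bigr do under eq_bigr do rewrite dist2.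
rewrite (sum_weighted_dist _ _ (fun i => b (xpt D i) (xpt D i))
  (fun i => b (ypt D i) (ypt D i)) (fun i j => b (xpt D i) (ypt D j))).
(* Once the two total weights agree, all terms in the squared norms of single points cancel. *)
rewrite !pairs (wt_balance D); ring.
Qed.

Hypothesis b_def : forall u, b u u = 0 -> u = 0.

Lemma gamma2_form_eq0 (s t : nat) (D : signed_simplex R X s t) :
  gamma2 (fun u => Num.sqrt (b u u)) D = 0 <->
  \sum_j sc (xwt D j) (xpt D j) = \sum_i sc (ywt D i) (ypt D i).
Proof.
rewrite gamma2_form /=; split=> [/b_def /subr0_eq //|->].
by rewrite bBl subrr.
Qed.

End RealForm.

Theorem theorem5p2 (R : realType) (s t : nat) (hs : (0 < s)%N) (ht : (0 < t)%N) :
  (* real inner product spaces *)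
  (forall (X : lmodType R) (ip : {dot X for @idfun R})
          (D : signed_simplex R X s t),
     gamma2 (rnorm ip) D = 0 <->
     \sum_(j < s) xwt D j *: xpt D j = \sum_(i < t) ywt D i *: ypt D i)
  /\
  (* complex inner product spaces *)
  (forall (X : lmodType R[i]) (ip : {dot X for @Num.conj R[i]})
          (D : signed_simplex R X s t),
     gamma2 (cnorm ip) D = 0 <->
     \sum_(j < s) (xwt D j)%:C%C *: xpt D j
       = \sum_(i < t) (ywt D i)%:C%C *: ypt D i).
Proof.
split=> X ip D.
  have ip_gt0 u : u != 0 -> 0 < ip u u by apply: neq0_dnorm_gt0.
  apply: (gamma2_form_eq0 (sc := *:%R) (b := ip)) => [u v|u v w|a u v|u|u].
  (* The sign [(-1) ^+ false] carried by [hermC] is 1 for an inner product. *)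
  - by rewrite hermC expr0 mul1r.
  - by rewrite linearBl.
  - by rewrite linearZl_LR.
  - by have [->|/ip_gt0/ltW //] := eqVneq u 0; rewrite linear0l.
  - by move=> u0; apply/eqP/negPn/negP => /ip_gt0; rewrite u0 ltxx.
(* Taking real parts turns conjugate symmetry into symmetry and keeps linearity over real
   scalars. *)
have Re_conj (z : R[i]) : complex.Re (Num.conj z) = complex.Re z by case: z.
have ReB (z w : R[i]) : complex.Re (z - w) = complex.Re z - complex.Re w.
  by case: z w => [? ?] [? ?].
have ReZ a (z : R[i]) : complex.Re (a%:C%C * z) = a * complex.Re z.
  by case: z => c d /=; rewrite mul0r subr0.
apply: (gamma2_form_eq0 (sc := fun a u => a%:C%C *: u)
  (b := fun u v => complex.Re (ip u v))) => [u v|u v w|a u v|u|u].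
- by rewrite hermC expr0 mul1r; exact: Re_conj.
- by rewrite linearBl; exact: ReB.
- by rewrite linearZl_LR; exact: ReZ.
- by have := dnorm_ge0 ip u; rewrite lecE => /andP[].
(* Being nonnegative in [R[i]], [ip u u] has zero imaginary part, so a zero real part makes it
   zero. *)
- move=> re0; apply/eqP; rewrite -(dnorm_eq0 ip) eq_complex re0 eqxx.
  by rewrite ger0_Im ?dnorm_ge0 /=.
Qed.
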